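(* Let $L\subset\mathbb N_{\ge 2}$ be a finite, nonempty subset. Then there are, up to isomorphism, only finitely many finite abelian groups $G$ such that $L\notin\mathcal L\big(\mathcal B_{\pm}(G)\big)$.
   Context: $\mathbb N_{\ge 2}$ is the set of integers $\ge 2$. For an additive abelian group $G$, $\mathcal F(G)$ is the (multiplicatively written) free abelian monoid with basis $G$, whose elements $S=g_1\cdot\ldots\cdot g_\ell$ (finite multisets) are called sequences over $G$. $\mathcal B_{\pm}(G)\subset\mathcal F(G)$ is the submonoid of all plus-minus weighted zero-sum sequences, i.e., sequences $g_1\cdot\ldots\cdot g_\ell$ for which there are $\varepsilon_1,\ldots,\varepsilon_\ell\in\{-1,1\}$ with $\varepsilon_1g_1+\ldots+\varepsilon_\ell g_\ell=0$. An atom of $H=\mathcal B_\pm(G)$ is an element $a\ne 1$ such that $a=bc$ with $b,c\in H$ implies $b=1$ or $c=1$. For $a\in H$, the set of lengths $\mathsf L_H(a)$ is the set of all $k\in\mathbb N_0$ such that $a$ is a product of $k$ atoms of $H$ (so $\mathsf L_H(1)=\{0\}$), and $\mathcal L(H)=\{\mathsf L_H(a): a\in H\}$ is the system of sets of lengths of $H$. *)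

(* Defs.v *)
From mathcomp Require Import all_boot all_order all_algebra.
From mathcomp Require Import finmap multiset.
From mathcomp Require Import boolp classical_sets cardinality.

Set Implicit Arguments.
Unset Strict Implicit.
Unset Printing Implicit Defensive.

Import GRing.Theory.

Local Open Scope mset_scope.
Local Open Scope classical_set_scope.
Local Open Scope nat_scope.

(* The free abelian monoid F(K) is {mset K}, with product the multiset sum
   msetD and unit the empty multiset mset0. A submonoid H of F(K) is given by
   its underlying set; the only unit of such an H is mset0. *)
Section Factorizations.
Variables (K : choiceType) (H : set {mset K}).

Definition atom (a : {mset K}) : Prop :=
  [/\ H a, a <> mset0 &
      forall b c : {mset K}, H b -> H c -> a = msetD b c ->
        b = mset0 \/ c = mset0].

(* The product of 0 atoms is mset0. *)
Definition set_of_lengths (a : {mset K}) : set nat :=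
  [set k | exists2 u : 'I_k -> {mset K},
     forall i, atom (u i) & a = \big[@msetD K/mset0]_(i < k) u i].

Definition system_of_sets_of_lengths : set (set nat) :=
  [set set_of_lengths a | a in H].

End Factorizations.

Definition pm_zero_sum (G : zmodType) : set {mset G} :=
  [set S | exists (l : nat) (g : 'I_l -> G) (eps : 'I_l -> int),
     [/\ S = seq_mset [seq g i | i : 'I_l],
         forall i, eps i = (- 1)%R \/ eps i = 1%R
       & (\sum_(i < l) g i *~ eps i = 0)%R]].

Definition zmod_isomorphic (G H : zmodType) : Prop :=
  exists f : {additive G -> H}, bijective f.

(* Main.v *)
(** Subtracting a constant from [L] amounts to removing that many zeros from a
    sequence, so assume [min L = 2]. Index a sequence by the points of a grid
    whose side lengths are the elements of [L], and choose its terms in [G] so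
    that every slice orthogonal to a coordinate axis has sum zero, while the
    coefficients [c] of any signed zero-sum are additively separable modulo some
    [d >= 2]: [c x = k + \sum_i f_i (x_i)]. Two separable functions with disjoint
    nonempty supports that do not cover the grid depend on one and the same
    coordinate. Hence a factorization into atoms has either two factors, or
    consists of all the slices along one axis, and the set of lengths is [L].

    The terms are integer combinations of boundedly many elements of [G] whose
    relations with small coefficients all vanish modulo [d]. In a large group
    such elements are picked greedily from the first of the sets
    [G[1], G[2], ..., G[B], G] that is much larger than all the previous ones. *)
Require Import Defs.
From HB Require Import structures.
From mathcomp Require Import all_boot all_order all_algebra.
From mathcomp Require Import finmap multiset.
From mathcomp Require Import boolp classical_sets cardinality.
From mathcomp Require Import fintype finset zify.

Set Implicit Arguments.
Unset Strict Implicit.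
Unset Printing Implicit Defensive.

Import Order.TTheory GRing.Theory Num.Theory.

Local Open Scope mset_scope.
Local Open Scope set_scope.
Local Open Scope nat_scope.

(** * Factorizations of a multiset as partitions of an index set *)

HB.instance Definition _ (K : choiceType) :=
  Monoid.isComLaw.Build {mset K} mset0 (@msetD K)
    (@msetDA K) (@msetDC K) (@mset0D K).

Lemma msetDI (K : choiceType) (A : {mset K}) : injective (msetD A).
Proof. exact: can_inj (msetDKB A). Qed.

Lemma big_msetDE (K : choiceType) (k : nat) (u : 'I_k -> {mset K}) (a : K) :
  (\big[@msetD K/mset0]_(i < k) u i)%mset a = \sum_(i < k) u i a.
Proof. by elim/big_rec2: _ => [|i n A _ <-]; rewrite ?mset0E // msetE2. Qed.

Section IndexedMultisets.
Variables (X : finType) (K : choiceType) (g : X -> K).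
Implicit Types P Q : {set X}.

Definition mset_image P : {mset K} := seq_mset [seq g x | x in P].

Lemma mset_imageE P a : mset_image P a = \sum_(x in P) (g x == a).
Proof.
rewrite mset_seqE -sum1_count big_map big_mkcond -big_enum /=.
by apply: eq_bigr => x _; case: (_ == _).
Qed.

Lemma mset_image0 : mset_image set0 = mset0.
Proof. by apply/msetP => a; rewrite mset_imageE big_set0 mset0E. Qed.

Lemma mset_image1 x : mset_image [set x] = [mset g x]%mset.
Proof.
by apply/msetP => a; rewrite mset_imageE big_set1 msetnE eq_sym; case: eqP.
Qed.

Lemma mset_imageID Q P : Q \subset P ->
  mset_image P = msetD (mset_image Q) (mset_image (P :\: Q)).
Proof.
move=> sQP; apply/msetP => a; rewrite msetE2 !mset_imageE (big_setID Q) /=.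
by rewrite (setIidPr sQP).
Qed.

Lemma mset_image_eq0 P : mset_image P = mset0 <-> P = set0.
Proof.
split=> [P0|->]; last exact: mset_image0.
apply/setP => x; rewrite inE; apply/negP => xP.
have /msetP/(_ (g x)) := P0.
by rewrite mset_imageE mset0E (bigD1 x) //= eqxx.
Qed.

(** Although [g] need not be injective, a factorization of the multiset lifts to the indices: pick
    an index [x] whose term lies in [A], strip it from both sides, and induct on the cardinality of
    [P]. *)
Lemma mset_image_split P A B : mset_image P = msetD A B ->
  exists2 Q : {set X}, Q \subset P & A = mset_image Q /\ B = mset_image (P :\: Q).
Proof.
have [n] := ubnP #|P|; elim: n => // n IHn in P A B *; rewrite ltnS => cardP PE.
have [A0|[a aA]] := mset_0Vmem A.
  exists set0; rewrite ?sub0set // setD0 mset_image0 A0.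
  by rewrite PE A0 mset0D.
have [x xP gx] : exists2 x, x \in P & g x = a.
  have : 0 < mset_image P a by rewrite PE msetE2 addn_gt0 mset_gt0 aA.
  rewrite mset_imageE lt0n sum_nat_eq0 negb_forall => /existsP[x].
  by rewrite negb_imply => /andP[xP]; case: (g x =P a) => // gx _; exists x.
have sxP : [set x] \subset P by rewrite sub1set.
pose A' := (A `\ a)%mset.
have AE : A = msetD [mset a] A' by rewrite /A' msetB1K.
have PE' : mset_image (P :\ x) = msetD A' B.
  apply: (@msetDI _ [mset a]%mset).
  by rewrite msetDA -AE -PE (mset_imageID sxP) mset_image1 gx.
have cardP' : #|P :\ x| < n by rewrite (cardsD1 x P) xP in cardP.
have [Q sQ [A'E BE]] := IHn _ _ _ cardP' PE'.
have xQ : x \notin Q by apply/negP => /(subsetP sQ); rewrite !inE eqxx.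
exists (x |: Q); last split.
- by rewrite subUset sxP (subset_trans sQ) // subD1set.
- rewrite AE A'E (@mset_imageID [set x] (x |: Q)) ?subsetUl //.
  by rewrite mset_image1 gx setU1K.
- by rewrite BE setDDl.
Qed.
End IndexedMultisets.

(** * Zero-sum index sets and lengths of factorizations *)

Section ZeroSumSets.
Variables (X : finType) (G : zmodType) (g : X -> G).
Implicit Types P Q : {set X}.

(** A choice of signs is recorded by the set [Q] of indices with sign [+1]. *)
Definition zero_sum_set P :=
  exists2 Q : {set X}, Q \subset P &
    (\sum_(x in Q) g x = \sum_(x in P :\: Q) g x)%R.

Definition atom_set P :=
  [/\ zero_sum_set P, P <> set0 &
      forall Q, Q \subset P -> zero_sum_set Q -> zero_sum_set (P :\: Q) ->
        Q = set0 \/ P :\: Q = set0].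

Lemma eq_mset_image_sum (Y : finType) (h : Y -> G) P (Q : {set Y}) :
  mset_image g P = mset_image h Q ->
  (\sum_(x in P) g x = \sum_(y in Q) h y)%R.
Proof.
move=> /eq_seq_msetP PQ.
by move: (perm_big _ PQ : \sum_(z <- _) z = _)%R; rewrite !big_image.
Qed.

Lemma pm_zero_sum_image P : pm_zero_sum (mset_image g P) <-> zero_sum_set P.
Proof.
split=> [[l [h [eps [PE eps1 sum0]]]]|[Q sQP sumE]].
  (* The signs come with another indexing [h] of the same multiset, so the split into positive and
     negative positions has to be carried over to [P]. *)
  pose E := [set i | eps i == 1%R].
  have hE : mset_image g P = mset_image h setT.
    rewrite PE /mset_image; congr seq_mset; congr map.
    by apply: eq_enum => i; rewrite !inE.
  have := hE; rewrite (mset_imageID h (subsetT E)) => /mset_image_split.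
  case=> Q sQP [QE DE]; exists Q => //.
  rewrite (eq_mset_image_sum (esym QE)) (eq_mset_image_sum (esym DE)).
  apply/eqP; rewrite -subr_eq0 -[X in _ == X]sum0 [X in _ == X](bigID [in E]) /=.
  apply/eqP; congr (_ + _)%R.
    by apply: eq_bigr => i; rewrite inE => /eqP ->.
  rewrite -[LHS]sumrN; apply: eq_big => [i|i]; first by rewrite !inE andbT.
  by rewrite !inE andbT; case: (eps1 i) => -> //; rewrite mulrN1z.
exists #|P|, (fun i => g (enum_val i)),
  (fun i => if enum_val i \in Q then 1%R else (-1)%R); split.
- apply/msetP => a; rewrite mset_imageE mset_seqE -sum1_count big_map.
  rewrite [RHS]big_mkcond [RHS]big_enum /= [LHS](@big_enum_val _ _ _ _ [in P]).
  by apply: eq_bigr => i _; case: (_ == _).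
- by move=> i; case: ifP; [right | left].
- rewrite -(@big_enum_val _ _ _ _ [in P] (fun x => g x *~ (if x \in Q then 1 else -1)))%R.
  rewrite (big_setID Q) /= (setIidPr sQP).
  rewrite (eq_bigr g) => [|x ->//]; rewrite sumE.
  rewrite [X in (_ + X)%R](eq_bigr (fun x => - g x)%R) ?sumrN ?subrr // => x.
  by rewrite inE => /andP[/negPf -> _]; rewrite mulrN1z.
Qed.

Lemma atom_image P : atom (@pm_zero_sum G) (mset_image g P) <-> atom_set P.
Proof.
split=> -[zP P0 decP].
  split; [exact/pm_zero_sum_image|by move/mset_image_eq0|move=> Q sQP].
  move=> /pm_zero_sum_image zQ /pm_zero_sum_image zPQ.
  have [|/mset_image_eq0|/mset_image_eq0] := decP _ _ zQ zPQ; auto.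
  exact: mset_imageID.
split; [exact/pm_zero_sum_image|by move/mset_image_eq0|move=> b c zb zc].
case/mset_image_split=> Q sQP [bE cE]; subst b c.
have [||->|->] := decP Q sQP; try exact/pm_zero_sum_image.
  by left; exact: mset_image0.
by right; exact: mset_image0.
Qed.

(** The factors are split off one at a time, starting with the last, and [lam] labels each index
    with its factor. Values of [lam] outside [P] carry no meaning. *)
Lemma mset_image_big_split k P (u : 'I_k -> {mset G}) :
  mset_image g P = (\big[@msetD G/mset0]_(i < k) u i)%mset ->
  exists2 lam : X -> nat, forall x, x \in P -> lam x < k &
    forall j : 'I_k, u j = mset_image g [set x in P | lam x == j].
Proof.
elim: k => [|k IHk] in P u *.
  rewrite big_ord0 => /mset_image_eq0 ->; exists (fun=> 0) => [x|[]//].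
  by rewrite inE.
rewrite big_ord_recr /= => /mset_image_split[Q sQP [/esym/IHk[lam lamP lamE] uk]].
exists (fun x => if x \in Q then lam x else k) => [x xP|j].
  by case: ifP => // /lamP /ltnW.
case: (unliftP ord_max j) => [i|] ->.
  have -> : lift ord_max i = widen_ord (leqnSn k) i.
    by apply: val_inj; rewrite /= /bump leqNgt ltn_ord.
  rewrite lamE; congr mset_image; apply/setP => x; rewrite !inE /=.
  case: ifP => xQ /=; first by rewrite (subsetP sQP).
  by rewrite gtn_eqF ?andbF.
rewrite uk; congr mset_image; apply/setP => x; rewrite !inE /=.
case: ifP => xQ /=; last by rewrite eqxx andbT.
by rewrite ltn_eqF ?andbF // lamP.
Qed.

Lemma big_mset_image k (lam : X -> 'I_k) :
  mset_image g setT =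
  (\big[@msetD G/mset0]_(j < k) mset_image g [set x | lam x == j])%mset.
Proof.
apply/msetP => a; rewrite mset_imageE big_msetDE.
rewrite (partition_big lam predT) //=; apply: eq_bigr => j _.
by rewrite mset_imageE; apply: eq_bigl => x; rewrite !inE.
Qed.

Lemma set_of_lengths_image k :
  set_of_lengths (@pm_zero_sum G) (mset_image g setT) k <->
  exists lam : X -> 'I_k, forall j, atom_set [set x | lam x == j].
Proof.
split=> [[u atomu /mset_image_big_split[lam lamk uE]]|[lam atoml]].
  exists (fun x => Ordinal (lamk x (in_setT x))) => j.
  have := atomu j; rewrite uE => /atom_image.
  by congr (atom_set _); apply/setP => x; rewrite !inE.
exists (fun j => mset_image g [set x | lam x == j]); last exact: big_mset_image.
by move=> j; apply/atom_image.
Qed.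

End ZeroSumSets.

(** * Zeros in a sequence shift its set of lengths *)

Section ZeroElement.
Variable G : zmodType.
Implicit Types a b : {mset G}.

Lemma pm_zero_sum_image_ex a : pm_zero_sum a ->
  exists (X : finType) (g : X -> G), a = mset_image g setT.
Proof.
case=> l [h [_ [-> _ _]]]; exists 'I_l, h; congr seq_mset; congr map.
by apply: eq_enum => i; rewrite !inE.
Qed.

Lemma pm_zero_sum0D a : pm_zero_sum (msetD [mset 0%R] a) <-> pm_zero_sum a.
Proof.
split=> [za|[l [h [eps [-> eps1 sum0]]]]].
  have [X [g aE]] := pm_zero_sum_image_ex za.
  have := za; rewrite aE => /pm_zero_sum_image[E _].
  (* [Q] holds the index of the extra zero; dropping it from either side of the signed sum changes
     nothing. *)
  have [Q _ [Q0 ->]] := mset_image_split (esym aE).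
  have g0 x : x \in Q -> g x = 0%R.
    move=> xQ; have /msetP/(_ (g x)) := Q0.
    rewrite mset_imageE (bigD1 x) //= eqxx msetnE.
    by case: eqP.
  have sumD P : (\sum_(x in P :\: Q) g x = \sum_(x in P) g x)%R.
    rewrite [RHS](big_setID Q) /= [X in (_ = X + _)%R]big1 ?add0r //.
    by move=> x; rewrite inE => /andP[_ /g0].
  move=> sumE; apply/pm_zero_sum_image; exists (E :\: Q); first by rewrite setSD ?subsetT.
  rewrite sumD sumE -sumD; apply: eq_bigl => x.
  by rewrite !inE; case: (x \in Q); rewrite ?andbF.
exists l.+1, (fun i => if unlift ord0 i is Some j then h j else 0%R),
  (fun i => if unlift ord0 i is Some j then eps j else 1%R); split.
- rewrite -mset_cons; congr seq_mset; rewrite /image_mem.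
  rewrite enum_ordSl /= unlift_none -map_comp.
  by congr cons; apply: eq_map => i /=; rewrite liftK.
- by move=> i; case: unliftP => [j _|_]; [exact: eps1|right].
- rewrite big_ord_recl unlift_none mul0rz add0r -[RHS]sum0.
  by apply: eq_bigr => i _; rewrite liftK.
Qed.

Lemma atom_mset0 : atom (@pm_zero_sum G) [mset 0%R].
Proof.
split=> [|/msetP/(_ 0%R)|b c _ _ bc].
- rewrite -[X in pm_zero_sum X]msetD0; apply/pm_zero_sum0D.
  exists 0, (fun=> 0%R), (fun=> 1%R); split=> [|[]//|]; last by rewrite big_ord0.
  apply/msetP => a; rewrite mset_seqE mset0E /image_mem.
  by rewrite (size0nil (size_enum_ord 0)).
- by rewrite msetnxx mset0E.
- have : [mset 0%R] = mset_image (fun _ : unit => 0%R : G) setT.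
    by rewrite -(mset_image1 (fun=> 0%R) tt); congr mset_image; apply/setP => -[]; rewrite !inE.
  rewrite bc => /esym/mset_image_split[Q _ [-> ->]].
  case: (boolP (tt \in Q)) => ttQ; [right|left]; apply/mset_image_eq0/setP => -[];
    by rewrite !inE ?ttQ // (negPf ttQ).
Qed.

(** The atom that contains 0 is 0 alone, since its remaining part is again a zero-sum sequence; so
    this factor can be cancelled. *)
Lemma set_of_lengths0D a k :
  set_of_lengths (@pm_zero_sum G) (msetD [mset 0%R] a) k.+1 <->
  set_of_lengths (@pm_zero_sum G) a k.
Proof.
split=> [[u atomu aE]|[u atomu aE]]; last first.
  exists (fun i => if unlift ord0 i is Some j then u j else [mset 0%R]).
    by move=> i; case: unliftP => [j _|_]; [exact: atomu|exact: atom_mset0].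
  rewrite big_ord_recl unlift_none aE; congr msetD.
  by apply: eq_bigr => i _; rewrite liftK.
have [j uj0] : exists j, 0 < u j 0%R.
  have /msetP/(_ 0%R) := aE; rewrite big_msetDE msetE2 msetnxx => /esym sumu.
  have : \sum_(i < k.+1) u i 0%R != 0 by rewrite sumu.
  by rewrite sum_nat_eq0 negb_forall => /existsP[j]; rewrite -lt0n; exists j.
have ujE : u j = [mset 0%R].
  have [zuj _ decu] := atomu j.
  have ujE : u j = msetD [mset 0%R] (u j `\ 0%R)%mset.
    by rewrite msetB1K // -mset_gt0.
  rewrite ujE; rewrite ujE in zuj; move/pm_zero_sum0D: zuj => zb.
  have [z0 _ _] := atom_mset0.
  have [/msetP/(_ 0%R)|->] := decu _ _ z0 zb ujE; last by rewrite msetD0.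
  by rewrite msetnxx mset0E.
exists (fun i => u (lift j i)) => [i|]; first exact: atomu.
by apply: (@msetDI _ [mset 0%R]); rewrite aE (bigD1_ord j) //= ujE.
Qed.

Lemma set_of_lengths_zeros c a k :
  set_of_lengths (@pm_zero_sum G) (iter c (msetD [mset 0%R]) a) k <->
  c <= k /\ set_of_lengths (@pm_zero_sum G) a (k - c).
Proof.
elim: c k => [|c IHc] [|k] /=; rewrite ?subn0 ?subSS ?ltnS.
- by split=> [|[]].
- by split=> [|[]].
- split=> [[u _ /msetP/(_ 0%R)]|[]//].
  by rewrite big_ord0 msetE2 msetnxx mset0E.
- by split=> [/set_of_lengths0D/IHc//|/IHc/set_of_lengths0D].
Qed.

End ZeroElement.

(** * Separable functions and cylinders on a grid *)

Section Grid.
Variables (I : finType) (T : I -> finType).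
Notation X := {dffun forall i, T i}.
Implicit Types (x y z : X) (P Q : {set X}).

Definition update x i (t : T i) : X := [ffun j => dfwith x t j].

Lemma update_in x i (t : T i) : update x t i = t.
Proof. by rewrite ffunE dfwith_in. Qed.

Lemma update_out x i (t : T i) j : i != j -> update x t j = x j.
Proof. by move=> ij; rewrite ffunE dfwith_out. Qed.

Definition separable (A : zmodType) (c : X -> A) :=
  exists k (f : forall i, T i -> A), forall x, (c x = k + \sum_i f i (x i))%R.

Section Separable.
Variable A : zmodType.
Implicit Types c : X -> A.
Local Open Scope ring_scope.

(** Changing only coordinate [i] changes only the summand [f i], so these differences add up to the
    total change from [x] to [y]. *)
Lemma separable_update c x y : separable c ->
  c y = c x + \sum_i (c (update x (y i)) - c x).
Proof.
case=> k [f cE].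
have dE i (t : T i) : c (update x t) - c x = f i t - f i (x i).
  rewrite !cE (bigD1 i) //= [X in _ - (_ + X)](bigD1 i) //= update_in.
  rewrite [X in _ + (_ + X) - _](eq_bigr (fun j => f j (x j))) => [|j ji].
    by rewrite opprD addrACA subrr add0r opprD addrACA subrr addr0.
  by rewrite update_out // eq_sym.
under eq_bigr do rewrite dE.
by rewrite !cE sumrB -addrA [X in _ = _ + X]addrC subrK.
Qed.

Lemma separable_update2 c x i (s : T i) j (t : T j) : separable c -> i != j ->
  c (update (update x s) t) = c (update x s) + (c (update x t) - c x).
Proof.
move=> sc ij; rewrite (separable_update x _ sc) (bigD1 j) //= update_in.
rewrite (bigD1 i) //= update_out 1?eq_sym // update_in.
rewrite big1 => [|l /andP[lj li]].
  by rewrite addr0 addrCA [X in _ + X = _]addrC subrK addrC.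
rewrite !update_out 1?eq_sym //.
rewrite [X in c X - _](_ : _ = x) ?subrr //.
by apply/ffunP => m; rewrite ffunE; case: dfwithP.
Qed.

(* At a common zero [x] of [c] and [c'], changing one coordinate moves the pair
   [(c, c')] along one of the two axes, and changes of different coordinates add
   up; so no two of them can move along different axes. *)
Lemma separable_disjoint c c' x y y' : separable c -> separable c' ->
    (forall z, c z = 0 \/ c' z = 0) ->
    c x = 0 -> c' x = 0 -> c y != 0 -> c' y' != 0 ->
  exists i, forall z, c z = c (update x (z i)) /\ c' z = c' (update x (z i)).
Proof.
move=> sc sc' cc' cx0 c'x0 cy0 c'y0.
have same i j (s : T i) (t : T j) :
    c (update x s) != 0 -> c' (update x t) != 0 -> i = j.
  move=> cs c't; apply/eqP; apply/negPn/negP => ij.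
  have c's : c' (update x s) = 0 by case: (cc' (update x s)) cs => // ->; rewrite eqxx.
  have ct : c (update x t) = 0 by case: (cc' (update x t)) c't => // ->; rewrite eqxx.
  have [] := cc' (update (update x s) t); rewrite separable_update2 //.
    by rewrite ct cx0 subrr addr0 => cs0; rewrite cs0 eqxx in cs.
  by rewrite c's c'x0 add0r subr0 => ct0; rewrite ct0 eqxx in c't.
have move_axis (b : X -> A) z : separable b -> b x = 0 -> b z != 0 ->
    exists i, b (update x (z i)) != 0.
  move=> sb bx bz; apply: contrapT => no; case/eqP: bz.
  rewrite (separable_update x z sb) bx add0r big1 // => i _; rewrite subr0.
  by apply/eqP; apply: contrapT => /negP bi; apply: no; exists i.
have [i ci] := move_axis c y sc cx0 cy0.
have [j c'j] := move_axis c' y' sc' c'x0 c'y0.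
have ij := same _ _ _ _ ci c'j.
have only (b : X -> A) z : separable b -> b x = 0 ->
    (forall l (t : T l), b (update x t) != 0 -> l = i) -> b z = b (update x (z i)).
  move=> sb bx bi; rewrite (separable_update x z sb) bx add0r (bigD1 i) //= subr0.
  rewrite big1 ?addr0 // => l li; rewrite subr0; apply/eqP.
  by apply: contraTT li => /bi ->; rewrite eqxx.
exists i => z; split; apply: only => // l t blt.
  by rewrite ij; exact: same blt c'j.
by apply/esym; exact: same ci blt.
Qed.

End Separable.

Definition cylinder i P := forall x y, x i = y i -> x \in P -> y \in P.

Definition slice i (t : T i) : {set X} := [set x : X | x i == t].

Lemma slice_cylinder i (t : T i) : cylinder i (slice t).
Proof. by move=> x y xy; rewrite !inE xy. Qed.

Arguments slice_cylinder {i} t.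

Lemma cylinderD i P Q : cylinder i P -> cylinder i Q -> cylinder i (P :\: Q).
Proof.
move=> cP cQ x y xy; rewrite !inE => /andP[xQ xP]; apply/andP; split.
  by apply: contraNN xQ; apply: cQ.
exact: cP xy xP.
Qed.

(** If [i] and [j] differ, any point of [P] can be moved to any [y] without leaving [P]: first set
    coordinate [j] to that of [y], then change all the others. *)
Lemma cylinder_inj i j P : cylinder i P -> cylinder j P ->
  P <> set0 -> P <> setT -> i = j.
Proof.
move=> ciP cjP /eqP/set0Pn[x xP] PT; apply: contrapT => /eqP ij; apply: PT.
apply/setP => y; rewrite inE.
apply: (cjP (update x (y j))); first by rewrite update_in.
by apply: (ciP x) => //; rewrite update_out // eq_sym.
Qed.

Section CylinderLengths.
Variables (G A : zmodType) (g : X -> G).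
Hypothesis zero_sum_separable : forall P, zero_sum_set g P ->
  exists2 c : X -> A, separable c & forall x, (x \in P) = (c x != 0%R).
Hypothesis zero_sum_cylinder : forall i P, cylinder i P -> zero_sum_set g P.
Variable o : X.
Hypothesis cardT : forall i, 1 < #|T i|.

(** A point outside the union is the common zero required by [separable_disjoint]; both functions
    then depend on one coordinate, and so do their supports. *)
Lemma zero_sum_disjoint P Q : zero_sum_set g P -> zero_sum_set g Q ->
    P <> set0 -> Q <> set0 -> [disjoint P & Q] -> P :|: Q <> setT ->
  exists i, cylinder i P /\ cylinder i Q.
Proof.
move=> /zero_sum_separable[c sc cP] /zero_sum_separable[c' sc' c'Q].
move=> /eqP/set0Pn[y yP] /eqP/set0Pn[y' yQ] dPQ /eqP PQT.
have [x] : exists x, x \notin P :|: Q.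
  by apply/existsP; rewrite -negb_forall; apply: contraNN PQT => /forallP PQ;
     apply/eqP/setP => x; rewrite PQ inE.
rewrite !inE negb_or cP c'Q !negbK => /andP[/eqP cx /eqP c'x].
have [|||i ci] := separable_disjoint sc sc' _ cx c'x (y := y) (y' := y').
- move=> z; have [zP|zP] := boolP (z \in P); [right|left]; apply/eqP/negbNE.
    by rewrite -c'Q (disjointFr dPQ zP).
  by rewrite -cP.
- by rewrite -cP.
- by rewrite -c'Q.
exists i; split=> z z' zz'; rewrite ?cP ?c'Q.
  by rewrite (ci z).1 (ci z').1 zz'.
by rewrite (ci z).2 (ci z').2 zz'.
Qed.

Lemma slice_neq0 i (t : T i) : slice t <> set0.
Proof. by move/setP/(_ (update o t)); rewrite !inE update_in eqxx. Qed.

Lemma exists_other i (t : T i) : exists t', t' != t.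
Proof.
have /card_gt0P[t'] : 0 < #|predC1 t| by rewrite cardC1; case: #|_| (cardT i) => [|[]].
by rewrite inE; exists t'.
Qed.

Lemma slice_neqT i (t : T i) : slice t <> setT.
Proof.
have [t' t't] := exists_other t; move/setP/(_ (update o t')).
by rewrite !inE update_in (negPf t't).
Qed.

(** A nonempty proper zero-sum part [Q] of the slice is compared with a parallel slice [t'].
    Together they miss a point, so [Q] depends on coordinate [i] alone and must be the entire
    slice. *)
Lemma atom_slice i (t : T i) : atom_set g (slice t).
Proof.
split; [exact: zero_sum_cylinder (slice_cylinder t)|exact: slice_neq0|].
move=> Q sQ zQ _; have [->|/eqP Q0] := eqVneq Q set0; first by left.
have [->|/eqP D0] := eqVneq (slice t :\: Q) set0; first by right.
have [t' t't] := exists_other t.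
have [||||j [cQ ct']] := zero_sum_disjoint zQ
  (zero_sum_cylinder (slice_cylinder t')) => //.
- exact: slice_neq0.
- rewrite disjoints_subset; apply/subsetP => x /(subsetP sQ).
  by rewrite !inE => /eqP ->; rewrite eq_sym.
- move/eqP/set0Pn: D0 => [x]; rewrite !inE => /andP[xQ /eqP xt] /setP/(_ x).
  by rewrite !inE (negPf xQ) xt eq_sym (negPf t't).
have ji : j = i.
  exact: cylinder_inj ct' (slice_cylinder t') (@slice_neq0 _ _) (@slice_neqT _ _).
subst j; case/eqP/set0Pn: Q0 => y yQ; right; apply/setP => x.
rewrite !inE andbC; case: eqP => //= xt; apply/negbTE; rewrite negbK.
apply: (cQ y) => //; rewrite xt.
by have := subsetP sQ y yQ; rewrite inE => /eqP.
Qed.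

Lemma atom_cylinder i P : atom_set g P -> cylinder i P ->
  exists t : T i, P = slice t.
Proof.
case=> _ /eqP/set0Pn[x xP] decP cP; exists (x i).
have sP : slice (x i) \subset P.
  by apply/subsetP => y; rewrite inE => /eqP yx; apply: cP xP.
have [||/slice_neq0//|] := decP _ sP.
- exact: zero_sum_cylinder (slice_cylinder _).
- exact: zero_sum_cylinder (cylinderD cP (slice_cylinder _)).
by move/eqP; rewrite setD_eq0 => Ps; apply/eqP; rewrite eqEsubset Ps.
Qed.

(** The side [i0] of length 2 puts 2 into the set anyway, so factorizations into two atoms, which
    may be irregular, need no analysis. *)
Lemma set_of_lengths_grid i0 k : #|T i0| = 2 ->
  set_of_lengths (@pm_zero_sum G) (mset_image g setT) k <->
  exists i, #|T i| = k.
Proof.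
move=> Ti0; rewrite set_of_lengths_image; split=> [[lam atoml]|[i Ti]]; last first.
  subst k; exists (fun x => enum_rank (x i)) => j.
  rewrite (_ : [set _ | _] = slice (enum_val j)); first exact: atom_slice.
  apply/setP => x; rewrite !inE.
  by rewrite -(inj_eq enum_val_inj) enum_rankK.
pose V j := [set x | lam x == j].
have V0 j : V j <> set0 by have [] := atoml j.
(* Without factors [o] has no label; a single factor would be the whole grid, which splits into a
   slice and its complement; two factors are covered by [i0]. *)
case: k => [|[|[|k]]] in lam atoml V V0 *.
- by case: (lam o).
- have /card_gt0P[t _] := ltnW (cardT i0).
  have [_ _ /(_ (slice t))] := atoml ord0.
  have -> : [set x | lam x == ord0] = setT by apply/setP => x; rewrite !inE ord1.
  case.
  + exact: subsetT.
  + exact: zero_sum_cylinder (slice_cylinder _).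
  + by apply: (@zero_sum_cylinder i0); apply: cylinderD => //; exact: slice_cylinder.
  + by move/slice_neq0.
  + by move/eqP; rewrite setD_eq0 subTset => /eqP/slice_neqT.
- by exists i0.
have disjV j j' : j != j' -> exists i, cylinder i (V j) /\ cylinder i (V j').
  move=> jj'; apply: zero_sum_disjoint => //.
  + by have [] := atoml j.
  + by have [] := atoml j'.
  + rewrite disjoints_subset; apply/subsetP => x; rewrite !inE => /eqP ->.
    by [].
  (* A third class keeps the union of two classes from covering the grid. *)
  + have [l /andP[lj lj']] : exists l, (l != j) && (l != j').
      have /card_gt0P[l] : 0 < #|~: [set j; j']|.
        by rewrite cardsCs setCK card_ord cards2; case: (_ != _).
      by rewrite !inE negb_or; exists l.
    have /eqP/set0Pn[x] := V0 l; rewrite inE => /eqP xl /setP/(_ x).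
    by rewrite !inE xl (negPf lj) (negPf lj').
have VT j : V j <> setT.
  move=> /setP VjT; have [l lj] : exists l, l != j.
    by exists (if j == ord0 then ord_max else ord0); rewrite eq_sym; case: ifP => [/eqP->|->].
  have /eqP/set0Pn[x] := V0 l; rewrite inE => /eqP xl.
  by have := VjT x; rewrite !inE xl (negPf lj).
(* This fixes the common axis: every other class shares an axis with [V ord0], whose axis is
   unique. *)
have [i [ci0 ci1]] := disjV ord0 ord_max isT.
have cylV j : exists t : T i, V j = slice t.
  apply: atom_cylinder; first exact: atoml.
  have [->//|j0] := eqVneq j ord0.
  have [i' [cij ci0']] := disjV j ord0 j0.
  by rewrite (cylinder_inj ci0 ci0' (@V0 _) (@VT _)).
have [tau tauP] := choice cylV.
exists i; rewrite -[RHS]card_ord.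
apply: (@bij_eq_card _ _ (fun t => lam (update o t))); exists tau => [t|j].
  have := tauP (lam (update o t)); move/setP/(_ (update o t)).
  by rewrite !inE update_in eqxx => /esym/eqP.
have := tauP j; move/setP/(_ (update o (tau j))).
by rewrite !inE update_in eqxx => /eqP.
Qed.

End CylinderLengths.
End Grid.

(** Asking for zero coefficients would be too much: in a group of small exponent, multiples of the
    exponent always give relations. *)
Definition independent_mod (G : zmodType) (J : finType) (e : J -> G) (B d : nat) :=
  forall m : J -> int, (forall j, `|m j| <= B)%N ->
    (\sum_j e j *~ m j = 0)%R -> forall j, (d %| m j)%Z.

(** * Group elements on the grid whose signed zero-sums are separable *)

Section GridVectors.
Variables (I : finType) (T : I -> finType).
Notation X := {dffun forall i, T i}.
Variables (o : X) (G : zmodType) (e : X -> G).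
Implicit Types (x y z : X) (P Q : {set X}).
Local Open Scope ring_scope.

(* The deviation of [c] vanishes everywhere iff [c] is separable. *)
Definition deviation (c : X -> int) y : int :=
  c y - c o - \sum_i (c (update o (y i)) - c o).

(** This is the transpose of the linear map [deviation], applied to [e]; a relation among the grid
    vectors thus becomes a relation among the [e y] with coefficients [deviation c y]. *)
Definition grid_vector x : G := \sum_y e y *~ deviation (fun z => (z == x)%:R) y.

Lemma sum_grid_vector (c : X -> int) :
  \sum_x grid_vector x *~ c x = \sum_y e y *~ deviation c y.
Proof.
have sum_delta z : \sum_x (z == x)%:R * c x = c z.
  rewrite (bigD1 z) //= eqxx mul1r big1 ?addr0 // => x xz.
  by rewrite eq_sym (negPf xz) mul0r.
under eq_bigr do rewrite /grid_vector mulrz_suml.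
rewrite exchange_big; apply: eq_bigr => y _ /=.
under eq_bigr do rewrite -mulrzA.
rewrite -mulrz_sumr; congr (_ *~ _).
under eq_bigr do rewrite /deviation !mulrBl mulr_suml.
rewrite !sumrB !sum_delta exchange_big /=; congr (_ - _).
apply: eq_bigr => i _; under eq_bigr do rewrite mulrBl.
by rewrite sumrB !sum_delta.
Qed.

(** The deviation combines [#|I| + 1] differences of values of [c], each at most 2 in absolute
    value. *)
Lemma deviation_bound (c : X -> int) y : (forall x, `|c x| <= 1)%N ->
  (`|deviation c y| <= 2 * #|I| + 2)%N.
Proof.
move=> c1.
have sub2 x z : `|c x - c z| <= 2.
  by move: (c1 x) (c1 z); move: (c x) (c z) => a b; lia.
have sum2 : `|\sum_i (c (update o (y i)) - c o)| <= (2 * #|I|)%:R.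
  apply: le_trans (ler_norm_sum _ _ _) _.
  apply: (le_trans (ler_sum _ (fun i _ => sub2 _ _))).
  by rewrite sumr_const natrM mulr_natr lexx.
have := sub2 y o; move: sum2; rewrite /deviation.
set s := \sum_i _; set t := c y - c o; lia.
Qed.

(** All signs can be [+1]: the indicator of a cylinder depends on one coordinate, so its deviation
    vanishes. *)
Lemma zero_sum_cylinder i P : cylinder i P -> zero_sum_set grid_vector P.
Proof.
move=> cP; exists P => //; rewrite setDv big_set0.
transitivity (\sum_x grid_vector x *~ (x \in P)%:R).
  by rewrite big_mkcond; apply: eq_bigr => x _; case: (x \in P).
have memP x y : x i = y i -> (x \in P) = (y \in P).
  by move=> xy; apply/idP/idP; apply: cP.
rewrite sum_grid_vector big1 // => y _; rewrite /deviation (bigD1 i) //= big1.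
  by rewrite addr0 (memP (update o (y i)) y) ?update_in // subrr mulr0z.
by move=> j ji; rewrite (memP (update o (y j)) o) ?subrr // update_out.
Qed.

Variable d : nat.
Hypothesis d_gt1 : (1 < d)%N.
Hypothesis indep_e : independent_mod e (2 * #|I| + 2) d.

(** The signs, extended by 0 outside [P], have deviation divisible by [d], hence are separable
    modulo [d]; as [d > 1], the signs stay nonzero there. *)
Lemma zero_sum_separable P : zero_sum_set grid_vector P ->
  exists2 c : X -> 'Z_d, separable c & forall x, (x \in P) = (c x != 0).
Proof.
case=> Q sQP sumQ.
pose c x : int := (x \in Q)%:R - (x \in P :\: Q)%:R.
have sum0 : \sum_x grid_vector x *~ c x = 0.
  under eq_bigr do rewrite mulrzBr.
  rewrite sumrB; apply/eqP; rewrite subr_eq0; apply/eqP.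
  have sumE (R : {set X}) :
      \sum_x grid_vector x *~ (x \in R)%:R = \sum_(x in R) grid_vector x.
    by rewrite [RHS]big_mkcond; apply: eq_bigr => x _; case: (x \in R).
  by rewrite !sumE.
have cP x : (x \in P) = (c x != 0) /\ (`|c x| <= 1)%N.
  rewrite /c !inE; have := subsetP sQP x.
  by case: (x \in Q) => [->|_] //=; case: (x \in P).
have intr0 (m : int) : (d %| m)%Z -> m%:~R = 0 :> 'Z_d.
  by case/dvdzP => q ->; rewrite intrM -pmulrn pchar_Zp ?mulr0.
exists (fun x => (c x)%:~R).
  exists (c o)%:~R, (fun i t => (c (update o t))%:~R - (c o)%:~R) => x.
  rewrite sum_grid_vector in sum0.
  have := indep_e (fun y => deviation_bound y (fun x => (cP x).2)) sum0 x.
  move=> /intr0/eqP; rewrite /deviation intrB subr_eq0 intrB => /eqP dev0.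
  apply/eqP; rewrite addrC -subr_eq dev0 raddf_sum /=.
  by apply/eqP/eq_bigr => i _; rewrite intrB.
move=> x; rewrite (cP x).1.
have : c x = 0 \/ c x = 1 \/ c x = -1 by have := (cP x).2; lia.
by case=> [->|[->|->]]; rewrite ?mulr0z ?eqxx // ?rmorphN /= ?oppr_eq0 oner_eq0.
Qed.

Hypothesis cardT : forall i, (1 < #|T i|)%N.

Lemma set_of_lengths_grid_vector i0 k : #|T i0| = 2%N ->
  set_of_lengths (@pm_zero_sum G) (mset_image grid_vector setT) k <->
  exists i, #|T i| = k.
Proof.
exact: (set_of_lengths_grid zero_sum_separable zero_sum_cylinder o cardT).
Qed.

End GridVectors.

(** * Independent elements modulo [d] in large groups *)

Section Independence.
Variable G : finZmodType.
Implicit Types (h : G) (F H : {set G}).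

Definition torsion m : {set G} := [set h | (h *+ m == 0)%R].

(** Each fibre of multiplication by [m] is empty or a coset of the [m]-torsion. *)
Lemma card_mulrn_preim m F : #|[set h | (h *+ m)%R \in F]| <= #|F| * #|torsion m|.
Proof.
rewrite -sum1_card (partition_big (fun h => h *+ m)%R [in F]) /=; last first.
  by move=> x; rewrite inE.
rewrite -sum_nat_const; apply: leq_sum => f fF.
rewrite sum1dep_card; set S := [set _ | _].
have [->|[h0]] := set_0Vmem S; first by rewrite cards0.
rewrite !inE => /andP[_ /eqP h0f].
rewrite -(card_imset _ (addIr (- h0)%R)); apply/subset_leq_card/subsetP => x.
by case/imsetP => h; rewrite !inE => /andP[_ /eqP hf] ->; rewrite mulrnBl hf h0f subrr.
Qed.

Variables (B n d K : nat) (H : {set G}).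
Hypotheses (d_gt1 : 1 < d) (d_le : d <= B.+1).
Hypothesis torH : d = B.+1 \/ forall h, h \in H -> (h *+ d = 0)%R.
Hypothesis card_torsion : forall m, 0 < m < d -> #|torsion m| <= K.
Hypothesis cardH : B * (2 * B).+1 ^ n * K < #|H|.

(** By counting: for each of the [d - 1 <= B] multipliers [m], at most [(2 * B).+1 ^ n * K] elements
    [h] have [h *+ m] among the small combinations, and [H] is larger than all these sets
    together. *)
Lemma exists_independent_step k (e : nat -> G) : k <= n ->
  exists2 h, h \in H & forall (u : nat -> int) m,
    (forall j, `|u j| <= B) -> 0 < m < d ->
    (h *+ m <> \sum_(j < k) e j *~ u j)%R.
Proof.
move=> kn.
(* Coefficients between [-B] and [B] are stored with a shift by [B]. *)
pose F := [set (\sum_(j < k) e j *~ ((f j : nat)%:Z - B%:Z))%R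
            | f : {ffun 'I_k -> 'I_(2 * B).+1}].
have cardF : #|F| <= (2 * B).+1 ^ n.
  apply: leq_trans (leq_imset_card _ _) _.
  by rewrite card_ffun !card_ord leq_pexp2l.
pose bad := \bigcup_(m < d | 0 < m) [set h | (h *+ m)%R \in F].
have cardbad : #|bad| <= B * (2 * B).+1 ^ n * K.
  apply: (@leq_trans (\sum_(m < d | 0 < m) (2 * B).+1 ^ n * K)).
    rewrite /bad; elim/big_rec2: _ => [|m s A m0 sA]; first by rewrite cards0.
    apply: leq_trans (leq_card_setU _ _) _; apply: leq_add sA.
    apply: leq_trans (card_mulrn_preim _ _) _.
    by rewrite leq_mul // card_torsion // m0 ltn_ord.
  rewrite sum_nat_const -mulnA leq_mul2r; apply/orP; right.
  have -> : #|[pred m : 'I_d | 0 < m]| = d.-1.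
    rewrite (eq_card (B := predC1 (Ordinal (ltnW d_gt1)))); last first.
      by move=> m; rewrite !inE lt0n -val_eqE.
    by rewrite cardC1 card_ord.
  by rewrite -ltnS prednK // ltnW.
have /subsetPn[h hH hbad] : ~~ (H \subset bad).
  by apply: contraL cardH => /subset_leq_card Hbad; rewrite -leqNgt (leq_trans Hbad).
exists h => // u m uB /andP[m0 md] hE; case/negP: hbad.
apply/bigcupP; exists (Ordinal md) => //; rewrite inE /= hE.
apply/imsetP; exists [ffun j : 'I_k => inord `|(u j + B%:Z)%R| : 'I_(2 * B).+1] => //.
apply: eq_bigr => j _; congr (_ *~ _)%R; rewrite ffunE inordK; have := uB j; lia.
Qed.

Lemma exists_independent_seq k : k <= n ->
  exists e : nat -> G, forall m : nat -> int, (forall j, `|m j| <= B) ->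
    (\sum_(j < k) e j *~ m j = 0)%R -> forall j, j < k -> (d %| m j)%Z.
Proof.
elim: k => [_|k IHk kn]; first by exists (fun=> 0%R).
have [e indep_e] := IHk (ltnW kn).
have [h hH hF] := exists_independent_step e (ltnW kn).
exists (fun j => if j == k then h else e j) => m mB.
rewrite big_ord_recr /= eqxx.
under eq_bigr => j _ do rewrite ltn_eqF //.
move=> sum0.
have [u uB uE] : exists2 u : nat -> int, (forall j, `|u j| <= B) &
    (h *+ `|m k| = \sum_(j < k) e j *~ u j)%R.
  have [m0|m0] := leP 0%R (m k).
    exists (fun j => - m j)%R => [j|]; first by rewrite abszN.
    rewrite pmulrn gez0_abs //; under eq_bigr do rewrite mulrNz.
    by apply/eqP; rewrite sumrN -addr_eq0 addrC sum0.
  exists m => //; rewrite pmulrn ltz0_abs // mulrNz; apply/eqP.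
  by rewrite eq_sym -addr_eq0 sum0.
(* Either [d] exceeds every admissible coefficient or it kills [h]. The choice of [h] then rules out
   a nonzero remainder, the last term vanishes, and the relation falls to the induction
   hypothesis. *)
have mod_d : (h *+ `|m k| = h *+ (`|m k| %% d))%R.
  case: torH => [dB|tor]; first by rewrite modn_small // dB ltnS.
  by rewrite {1}(divn_eq `|m k| d) mulrnDr mulnC mulrnA tor // mul0rn add0r.
have r0 : `|m k| %% d = 0.
  apply/eqP; rewrite -leqn0 leqNgt; apply/negP => r0.
  by case: (hF u (`|m k| %% d) uB); rewrite ?r0 ?ltn_mod ?(ltnW d_gt1) // -mod_d.
have hm0 : (h *~ m k = 0)%R.
  have : (h *+ `|m k| = 0)%R by rewrite mod_d r0.
  by rewrite pmulrn; case: (intP (m k)) => [|p|p] //; rewrite ?abszN // mulrNz => ->; rewrite oppr0.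
move=> j; rewrite ltnS leq_eqVlt => /predU1P[->|jk].
  by rewrite -[(_ %| _)%Z]/(d %| `|m k|)%N /dvdn r0.
by apply: indep_e jk => //; rewrite hm0 addr0 in sum0.
Qed.

End Independence.

Lemma independent_ex B (J : finType) : 0 < B ->
  exists N, forall G : finZmodType, N < #|G| ->
  exists (d : nat) (e : J -> G), 1 < d /\ independent_mod e B d.
Proof.
move=> B0; pose n := #|J|; pose M := B * (2 * B).+1 ^ n.
have M0 : 0 < M by rewrite muln_gt0 B0 expn_gt0.
(* Take the least [d] with [#|Ht d| > M ^ d.-1]. The value 1 fails because the 1-torsion is trivial,
   and [B.+1] qualifies by the choice of [N]. By minimality the smaller torsion groups have at most
   [M ^ d.-2] elements, a factor [M] below [#|Ht d|]. *)
exists (M ^ B) => G cardG.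
pose Ht m := if m <= B then torsion G m else setT.
pose big m := (0 < m) && (M ^ m.-1 < #|Ht m|).
have exbig : exists m, big m.
  by exists B.+1; rewrite /big /Ht ltnn cardsT.
case: (ex_minnP exbig) => d /andP[d0 dbig] dmin.
have d_gt1 : 1 < d.
  rewrite ltn_neqAle d0 andbT; apply/eqP => d1.
  move: dbig; rewrite -d1 /Ht B0 expn0 ltnNge => /negP; apply.
  rewrite -[X in _ <= X](cards1 (0 : G)%R).
  by apply/subset_leq_card/subsetP => h; rewrite !inE mulr1n.
have d_le : d <= B.+1 by apply: dmin; rewrite /big /Ht ltnn cardsT.
have torH : d = B.+1 \/ forall h, h \in Ht d -> (h *+ d = 0)%R.
  move: d_le; rewrite leq_eqVlt ltnS => /predU1P[|dB]; first by left.
  by right=> h; rewrite /Ht dB inE => /eqP.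
have tor_le m : 0 < m < d -> #|torsion G m| <= M ^ d.-2.
  case/andP=> m0 md; have mB : m <= B by rewrite -ltnS (leq_trans md).
  have : ~~ big m by apply/negP => /dmin; rewrite leqNgt md.
  rewrite /big m0 /Ht mB -leqNgt => /leq_trans; apply.
  rewrite leq_pexp2l //; lia.
have cardH : B * (2 * B).+1 ^ n * M ^ d.-2 < #|Ht d|.
  by rewrite -/M -expnS; case: d d_gt1 {d0 dmin d_le torH tor_le} dbig => [|[]].
have [e indep_e] := exists_independent_seq d_gt1 d_le torH tor_le cardH (leqnn n).
exists d, (fun j => e (enum_rank j)); split=> // m mB sum0 j.
(* The coefficients are numbered along [J] and extended by 0 to all naturals. *)
pose m' i : int := if insub i is Some k then m (enum_val (k : 'I_n)) else 0%R.
have m'E j' : m' (enum_rank j') = m j' by rewrite /m' valK enum_rankK.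
rewrite -m'E; apply: indep_e (ltn_ord _) => [i|]; first by rewrite /m'; case: insub.
rewrite (reindex (@enum_rank J)) /=; last exact: (onW_bij _ (@enum_rank_bij J)).
by under eq_bigr do rewrite m'E.
Qed.

(** * Finitely many groups of bounded order *)

Lemma bij_additive_isomorphic (G H : zmodType) (phi : G -> H) :
  bijective phi -> {morph phi : x y / (x + y)%R} -> zmod_isomorphic G H.
Proof.
move=> bij_phi phiD.
have phi0 : phi 0%R = 0%R.
  by apply: (addrI (phi 0%R)); rewrite -phiD !addr0.
pose m := GRing.isNmodMorphism.Build G H phi (conj phi0 phiD).
pose F : {additive G -> H} := HB.pack phi m.
by exists F.
Qed.

(* A finite group is determined up to isomorphism by its addition table, and
   there are finitely many tables of bounded order. *)
Lemma finitely_many_zmod_le N : exists (n : nat) (K : 'I_n -> finZmodType),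
  forall G : finZmodType, #|G| <= N -> exists i : 'I_n, zmod_isomorphic G (K i).
Proof.
pose tables : finType := {m : 'I_N.+1 & {ffun 'I_m * 'I_m -> 'I_m}}.
pose has_table (t : tables) (G : finZmodType) := exists2 f : G -> 'I_(tag t),
  bijective f & forall x y, f (x + y)%R = tagged t (f x, f y).
(* ['Z_2] is a filler for tables that belong to no group. *)
pose K (i : 'I_#|tables|) : finZmodType :=
  if pselect (exists G, has_table (enum_val i) G) is left ex then projT1 (cid ex)
  else 'Z_2.
exists #|tables|, K => G cardG.
have ltG : #|G| < N.+1 by [].
pose t : tables := Tagged (fun m : 'I_N.+1 => {ffun 'I_m * 'I_m -> 'I_m})
  (i := Ordinal ltG)
  [ffun p : 'I_#|G| * 'I_#|G| => enum_rank (enum_val p.1 + enum_val p.2)%R].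
have Gt : has_table t G.
  exists enum_rank; first exact: enum_rank_bij.
  by move=> x y; rewrite /t /= ffunE /= !enum_rankK.
exists (enum_rank t); rewrite /K enum_rankK.
case: pselect => [ex|[]]; last by exists G.
case: (cid ex) => H [f' [f'1 f'K Kf'] f'D] /=; have [f bij_f fD] := Gt.
apply: (@bij_additive_isomorphic _ _ (f'1 \o f)).
  by apply: bij_comp bij_f; exists f'.
by move=> x y /=; rewrite fD -[in LHS](Kf' (f x)) -[in LHS](Kf' (f y)) -f'D f'K.
Qed.

(** * Realizing [L] in every large group *)

Local Open Scope classical_set_scope.
Local Open Scope nat_scope.

Lemma large_group_realizes (L : set nat) (hL2 : L `<=` [set k | 2 <= k])
    (hLfin : finite_set L) (hL0 : L !=set0) :
  exists N, forall G : finZmodType, N < #|G| ->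
    system_of_sets_of_lengths (@pm_zero_sum G) L.
Proof.
have /finite_seqP[s Ls] := hLfin.
have exL : exists l, l \in s by case: hL0 => l; rewrite Ls; exists l.
case: (ex_minnP exL) => l0 l0s l0min.
have memL l : L l <-> l \in s by rewrite Ls.
have l0_ge2 : 2 <= l0 by apply/hL2/memL.
pose c := l0 - 2.
pose T (i : seq_sub s) : finType := 'I_(ssval i - c).
have Tgt (i : seq_sub s) : 1 < ssval i - c by have := l0min _ (ssvalP i); rewrite /c; lia.
have cardT (i : seq_sub s) : 1 < #|T i| by rewrite card_ord Tgt.
pose i0 : seq_sub s := SeqSub l0s.
have cardT0 : #|T i0| = 2 by rewrite card_ord /= /c; lia.
pose o : {dffun forall i, T i} := [ffun i => Ordinal (ltnW (Tgt i)) : T i].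
have B0 : 0 < 2 * #|{: seq_sub s}| + 2 by rewrite addn2.
(* The grid and the coefficient bound depend on [L] only, so one [N] serves all groups. *)
have [N large] := @independent_ex _ {dffun forall i, T i} B0.
exists N => G /large[d [e [d_gt1 indep_e]]].
pose g := grid_vector o e.
have lengths_g := set_of_lengths_grid_vector o d_gt1 indep_e cardT.
exists (iter c (msetD [mset 0%R]) (mset_image g setT)).
  (* The whole grid is trivially a cylinder, hence zero-sum, and the added zeros preserve this. *)
  elim: {1}c => [|c' IHc] /=; last exact/pm_zero_sum0D.
  apply/pm_zero_sum_image/(@zero_sum_cylinder _ _ o G e i0) => x y _ _.
  by rewrite !inE.
apply/seteqP; split=> k.
  case/set_of_lengths_zeros=> ck /(lengths_g _ _ cardT0)[i].
  rewrite card_ord => ik; apply/memL.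
  have ci : c <= ssval i by rewrite ltnW // -subn_gt0 ltnW.
  by rewrite -(subnK ck) -ik subnK //; exact: ssvalP.
move/memL => ks; apply/set_of_lengths_zeros.
have := Tgt (SeqSub ks) => /= kc; split; first lia.
by apply/(lengths_g _ _ cardT0); exists (SeqSub ks); rewrite card_ord.
Qed.

Theorem corollary1p2 (L : set nat) (hL2 : L `<=` [set k | 2 <= k])
    (hLfin : finite_set L) (hL0 : L !=set0) :
  exists (n : nat) (K : 'I_n -> finZmodType),
    forall G : finZmodType,
      ~ system_of_sets_of_lengths (@pm_zero_sum G) L ->
      exists i : 'I_n, zmod_isomorphic G (K i).
Proof.
have [N large] := large_group_realizes hL2 hLfin hL0.
have [n [K allK]] := finitely_many_zmod_le N.
exists n, K => G notL; apply: allK; rewrite leqNgt.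
by apply/negP => /large.
Qed.
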